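(* Let $L$ be a finite geometric lattice with atom set $A$. For $y\in L$ and $a\in A$, \[ L_a^\beta e_y=\sum_{\substack{x\lessdot y\\ x\vee a=y}}\frac{\beta_x}{\beta_y}\,e_x. \] The linear map $\Phi_\beta$ from $\mathbb R[L]$ to the space of multiaffine polynomials in $(z_a)_{a\in A}$, given by $\Phi_\beta(e_x)=B_x(z)/\beta_x$, is injective and intertwines $L_a^\beta$ with $\partial_a$; that is, $\Phi_\beta(L_a^\beta e_y)=\partial_a\Phi_\beta(e_y)$ for all $a\in A$, $y\in L$.
   Context: $\mathbb R[L]$ is the real vector space with basis $(e_x)_{x\in L}$; $x\lessdot y$ means that $y$ covers $x$ in $L$; $\mathrm{rk}$ is the rank function and $\hat 0$ the bottom element. For an atom $a$, the linear operator $L_a$ on $\mathbb R[L]$ is $L_ae_x=e_{x\vee a}$ if $a\not\le x$, and $L_ae_x=0$ if $a\le x$ (multiplication by $e_a$ in the graded Möbius algebra). A basis of $x\in L$ is a set $I$ of $\mathrm{rk}(x)$ atoms with join $x$; $\beta_x$ is the number of ordered atom bases of $x$, i.e. $\mathrm{rk}(x)!$ times the number of bases of $x$ (so $\beta_{\hat 0}=1$). Equip $\mathbb R[L]$ with the inner product $\langle e_x,e_y\rangle_\beta=\delta_{x,y}/\beta_x$, and let $L_a^\beta$ be the adjoint of $L_a$: $\langle L_ae_x,e_y\rangle_\beta=\langle e_x,L_a^\beta e_y\rangle_\beta$ for all $x,y$. For $x\in L$, $B_x(z)=\sum_{I\text{ a basis of }x}z^I$, where $z=(z_a)_{a\in A}$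 and $z^I=\prod_{a\in I}z_a$. The space of multiaffine polynomials (real span of the monomials $z^I$, $I\subseteq A$) is identified with the underlying vector space of the squarefree algebra $\mathbb R[z_a:a\in A]/(z_a^2:a\in A)$, and $\partial_a$ is the usual partial derivative $\partial/\partial z_a$ on multiaffine polynomials. *)

(* Defs.v *)
From HB Require Import structures.
From mathcomp Require Import all_boot all_order all_algebra.
From mathcomp Require Import reals mpoly.

Set Implicit Arguments.
Unset Strict Implicit.
Unset Printing Implicit Defensive.

Import Order.TTheory GRing.Theory Num.Theory.
Local Open Scope ring_scope.

Section Lattice.
Context {d : Order.disp_t} {L : finTBLatticeType d}.
Implicit Types x y : L.

Definition covers x y : bool :=
  (x < y)%O && [forall z : L, ~~ (x < z < y)%O].

Definition is_atom x : bool := covers \bot%O x.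

Definition is_chain (C : {set L}) : bool :=
  [forall x in C, forall y in C, (x >=< y)%O].

(* The length of a chain C is #|C| - 1; rank x is the height of x, i.e. the
   length of a longest chain of elements below x. In a graded lattice this is
   the rank function. *)
Definition rank x : nat :=
  \max_(C : {set L} | is_chain C && [forall y in C, (y <= x)%O]) #|C|.-1.

End Lattice.

Notation atom_of L := {a : L | is_atom a}.

Section Geometric.
Context {d : Order.disp_t} (L : finTBLatticeType d).

Definition is_graded : Prop :=
  forall x y : L, covers x y -> rank y = (rank x).+1.

Definition is_semimodular : Prop :=
  forall x y : L,
    (rank (x `&` y)%O + rank (x `|` y)%O <= rank x + rank y)%N.

Definition is_atomistic : Prop :=
  forall x : L, exists I : {set atom_of L}, x = (\join_(a in I) val a)%O.

Definition geometric : Prop :=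
  [/\ is_graded, is_semimodular & is_atomistic].

End Geometric.

Section Bases.
Context {d : Order.disp_t} {L : finTBLatticeType d}.

Definition bases (x : L) : {set {set atom_of L}} :=
  [set I : {set atom_of L} |
    (#|I| == rank x) && ((\join_(a in I) val a)%O == x)].

Definition beta (x : L) : nat := ((rank x)`! * #|bases x|)%N.

End Bases.

(* The vector space R[L], as finitely indexed families of coefficients; R^o is
   R seen as a module over itself. *)
Notation freemod R L := {ffun L -> R^o}.

Section Operators.
Context {R : realType} {d : Order.disp_t} {L : finTBLatticeType d}.
Implicit Types (x y : L) (a : atom_of L).

Definition evec x : freemod R L := [ffun y => (y == x)%:R].

Section LinearExtension.
Context {V : lmodType R}.

Definition lin_ext (f : L -> V) (v : freemod R L) : V :=
  \sum_x v x *: f x.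

Lemma lin_ext_is_linear f : linear (lin_ext f).
Proof.
move=> c u v; rewrite /lin_ext scaler_sumr -big_split /=.
by apply: eq_bigr => x _; rewrite !ffunE scalerDl scalerA.
Qed.

HB.instance Definition _ f :=
  GRing.isLinear.Build R (freemod R L) V *:%R (lin_ext f) (lin_ext_is_linear f).

Lemma lin_ext_e f x : lin_ext f (evec x) = f x.
Proof.
rewrite /lin_ext (bigD1 x) //= ffunE eqxx scale1r big1 ?addr0 // => y nyx.
by rewrite ffunE (negPf nyx) scale0r.
Qed.

End LinearExtension.

Definition mul_atom a : {linear freemod R L -> freemod R L} :=
  lin_ext (fun x => if (val a <= x)%O then 0 else evec (x `|` val a)%O).

Definition ip_beta (u v : freemod R L) : R :=
  \sum_x u x * v x / (beta x)%:R.

Definition is_adjoint_beta (T M : {linear freemod R L -> freemod R L}) : Prop :=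
  forall x y, ip_beta (T (evec x)) (evec y) = ip_beta (evec x) (M (evec y)).

(* Polynomials in the variables (z_a), where a ranges over the atoms: z_a is
   the variable whose index is the rank of a in the enumeration of the atoms. *)
Definition polyA := {mpoly R[#|{: atom_of L}|]}.

Definition zmon (I : {set atom_of L}) : polyA :=
  \prod_(a in I) 'X_(enum_rank a).

Definition pderiv a (p : polyA) : polyA := mderiv (enum_rank a) p.

Definition multiaffine (p : polyA) : Prop :=
  exists c : {set atom_of L} -> R, p = \sum_I c I *: zmon I.

Definition basis_poly x : polyA := \sum_(I in bases x) zmon I.

Definition Phi_beta : {linear freemod R L -> polyA} :=
  lin_ext (fun x => (beta x)%:R^-1 *: basis_poly x).

End Operators.

Arguments polyA R {d} L.

(* Well-posedness: in a geometric lattice the weights beta are nonzero, so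
   ip_beta is an inner product and every operator has a unique adjoint. *)
Section WellPosed.
Context {d : Order.disp_t} {L : finTBLatticeType d}.

Lemma rank_bot : rank (\bot%O : L) = 0%N.
Proof.
apply/eqP; rewrite -leqn0; apply/bigmax_leqP => C /andP[_ /forall_inP leC].
have sC : C \subset [set \bot%O : L].
  by apply/subsetP=> y /leC; rewrite lex0 inE.
by have := subset_leq_card sC; rewrite cards1; case: #|C| => [|[]].
Qed.

Lemma lower_cover (x : L) : x != \bot%O -> exists y, covers y x.
Proof.
rewrite -lt0x => x_gt0.
pose M (y : L) := #|[set z : L | (z <= y)%O]|.
case: (@arg_maxnP _ \bot%O (fun y : L => (y < x)%O) M x_gt0) => y ltyx maxy.
exists y; rewrite /covers ltyx; apply/forallP => z; apply/negP => /andP[yz zx].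
have : (M z <= M y)%N := maxy z zx; rewrite leqNgt => /negP; apply.
apply/proper_card/properP; split.
  by apply/subsetP=> t; rewrite !inE => /le_trans; apply; apply: ltW.
by exists z; rewrite inE ?lexx ?(lt_geF yz).
Qed.

Lemma has_basis (x : L) : geometric L -> exists I, I \in bases x.
Proof.
move=> [gr _ atm]; move: {2}(rank x) (erefl (rank x)) => n.
elim: n x => [|n IHn] x rx.
  have [->|/lower_cover [y /gr]] := eqVneq x \bot%O; last by rewrite rx.
  by exists set0; rewrite inE cards0 rank_bot big_set0 !eqxx.
have [x0|/lower_cover [y cyx]] := eqVneq x \bot%O; first by rewrite x0 rank_bot in rx.
have [J JP] : exists J, J \in bases y.
  by apply: IHn; have := gr _ _ cyx; rewrite rx => -[].
case/andP: (cyx) => ltyx /forallP ncyx.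
have [K xK] := atm x.
have [/forall_inP leK|] := boolP [forall a in K, (val a <= y)%O].
  have : (x <= y)%O by rewrite xK; apply/joinsP.
  by rewrite lt_geF.
rewrite negb_forall_in => /exists_inP[a aK nay].
move: JP; rewrite inE => /andP[/eqP cJ /eqP jJ].
have lax : (val a <= x)%O by rewrite xK; apply: joins_sup.
have naJ : a \notin J.
  by apply: contra nay => aJ; rewrite -jJ; apply: joins_sup.
exists (a |: J); rewrite inE cardsU1 naJ cJ add1n (gr _ _ cyx) eqxx /=.
rewrite big_setU1 //= jJ.
have : (val a `|` y <= x)%O by rewrite leUx lax ltW.
rewrite le_eqVlt => /orP[//|ltax].
case/negP: (ncyx (val a `|` y)%O); rewrite ltax andbT lt_neqAle leUr andbT.
by apply: contra nay => /eqP {1}->; rewrite leUl.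
Qed.

Lemma beta_gt0 (x : L) : geometric L -> (0 < beta x)%N.
Proof.
move=> /(has_basis x)[I Ix]; rewrite muln_gt0 fact_gt0 /=.
by apply/card_gt0P; exists I.
Qed.

Context {R : realType}.

Lemma ip_beta_el x (v : freemod R L) : ip_beta (evec x) v = v x / (beta x)%:R.
Proof.
rewrite /ip_beta (bigD1 x) //= ffunE eqxx mul1r big1 ?addr0 // => y nyx.
by rewrite ffunE (negPf nyx) !mul0r.
Qed.

Lemma adjoint_exists (T : {linear freemod R L -> freemod R L}) :
  geometric L -> exists M, is_adjoint_beta T M.
Proof.
move=> gL.
pose M y : freemod R L :=
  [ffun x => (beta x)%:R * ip_beta (T (evec x)) (evec y)].
exists (lin_ext M).
move=> x y; rewrite ip_beta_el /= lin_ext_e ffunE mulrAC mulfV ?mul1r //.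
by rewrite pnatr_eq0 -lt0n beta_gt0.
Qed.

Lemma adjoint_unique (T M N : {linear freemod R L -> freemod R L}) :
  geometric L -> is_adjoint_beta T M -> is_adjoint_beta T N -> M =1 N.
Proof.
move=> gL TM TN v.
have -> : v = \sum_y v y *: evec y.
  apply/ffunP=> x; rewrite sum_ffunE (bigD1 x) //= !ffunE eqxx big1 ?addr0.
    by rewrite /GRing.scale /= mulr1.
  by move=> y nyx; rewrite !ffunE eq_sym (negPf nyx) scaler0.
rewrite !linear_sum; apply: eq_bigr => y _; rewrite !linearZ; congr (_ *: _).
apply/ffunP=> x; have := TM x y; rewrite TN !ip_beta_el => /mulIf -> //.
by rewrite invr_eq0 pnatr_eq0 -lt0n beta_gt0.
Qed.

End WellPosed.

(* Main.v *)
Require Import Defs.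
From mathcomp Require Import all_boot all_order all_algebra.
From mathcomp Require Import reals mpoly.
Import Order.TTheory GRing.Theory Num.Theory.
Local Open Scope ring_scope.

(** In the basis [evec x], whose Gram matrix is diagonal with entries
    [1 / beta x], the adjoint of [mul_atom a] has matrix the transpose of that
    of [mul_atom a] rescaled by [beta x / beta y].  Its support consists of the
    pairs [(x, y)] with [a] not below [x] and [x `|` a = y]; semimodularity says
    that joining an atom raises the rank by at most one, so these are exactly
    the pairs with [x] covered by [y] and [x `|` a = y]
    ([covers_join_atom]).

    The same rank bound shows that the rank of a join of atoms is at most their
    number, hence that the bases of [y] through [a] are exactly the sets
    [a |: J] where [J] is a basis of some [x] covered by [y] with
    [x `|` a = y], namely of the join of [J] ([basis_setU1]).  Deriving
    [basis_poly y] along [a] keeps the bases through [a] and deletes [a] from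
    them; so it gives the sum of the [basis_poly x] over those [x].  The
    factors [beta x] cancel between [Phi_beta] and the adjoint, which leaves
    [1 / beta y] on both sides.

    Injectivity holds because a set of atoms is a basis of at most one element,
    its join: the supports of the polynomials [basis_poly x] are pairwise
    disjoint, and nonempty since every [x] has a basis. *)

(** * Rank in a geometric lattice *)

Section Rank.
Context {d : Order.disp_t} {L : finTBLatticeType d}.
Implicit Types (x y : L) (a : atom_of L) (I J : {set atom_of L}).

(** Adding [y] to a longest chain below [x] gives a longer chain below [y]. *)
Lemma ltn_rank x y : (x < y)%O -> (rank x < rank y)%N.
Proof.
move=> ltxy.
pose below (z : L) (C : {set L}) :=
  is_chain C && [forall t in C, (t <= z)%O].
(* The truncation #|C|.-1 identifies the empty chain with a singleton, so the
   longest chain has to be taken nonempty. *)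
have [C [/andP[/forall_inP chC /forall_inP leC] C0 ->]] :
    exists C, [/\ below x C, (0 < #|C|)%N & rank x = #|C|.-1].
  have x1P : below x [set x].
    apply/andP; split; apply/forall_inP => t /set1P->; last by [].
    by apply/forall_inP => u /set1P->; rewrite comparablexx.
  have nbelow : (0 < #|below x|)%N by apply/card_gt0P; exists [set x].
  have [C CP rC] := eq_bigmax_cond (fun C : {set L} => #|C|.-1) nbelow.
  have [C0|C0] := posnP #|C|; last by exists C; split.
  exists [set x]; rewrite x1P cards1; split=> //.
  by rewrite [rank x]rC C0.
have yC : y \notin C by apply: contraL ltxy => /leC; apply: contraL => /lt_geF->.
have leCy t : t \in C -> (t <= y)%O.
  by move=> /leC/le_trans; apply; apply: ltW.
have yCP : below y (y |: C).
  apply/andP; split; apply/forall_inP => t /setU1P[->|tC] //; last exact: leCy.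
    apply/forall_inP => u /setU1P[->|uC]; first exact: comparablexx.
    by rewrite /Order.comparable (leCy _ uC) orbT.
  apply/forall_inP => u /setU1P[->|uC]; first by rewrite /Order.comparable leCy.
  exact: (forall_inP (chC _ tC)).
have := @leq_bigmax_cond _ (below y) (fun C : {set L} => #|C|.-1) _ yCP.
by rewrite cardsU1 yC add1n /= (prednK C0).
Qed.

Hypothesis gL : geometric L.

Lemma rank_join_atom x a : (rank (x `|` val a)%O <= (rank x).+1)%N.
Proof.
have [gr sm _] := gL.
have ra : rank (val a) = 1%N by rewrite (gr _ _ (valP a)) rank_bot.
by have := sm x (val a); rewrite ra addn1; apply: leq_trans; apply: leq_addl.
Qed.

Lemma rank_joins_atoms I : (rank (\join_(a in I) val a)%O <= #|I|)%N.
Proof.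
rewrite -sum1_card; elim/big_rec2: _ => [|a x n _ le_xn].
  by rewrite rank_bot.
by rewrite joinC; apply: leq_trans (rank_join_atom _ _) _.
Qed.

(** Joining an atom raises the rank by at most one, which leaves no room for an
    element strictly between [x] and [x `|` a]. *)
Lemma covers_join_atom x a : covers x (x `|` val a)%O = ~~ (val a <= x)%O.
Proof.
apply/idP/idP => [/andP[ltx _]|nax].
  by apply: contraL ltx => /join_idPl ->; rewrite ltxx.
have ltx : (x < x `|` val a)%O.
  by rewrite lt_neqAle leUl andbT eq_sym; apply: contra nax => /eqP <-; rewrite leUr.
rewrite /covers ltx; apply/forallP => z; apply/negP => /andP[/ltn_rank xz].
by move=> /ltn_rank /leq_trans /(_ (rank_join_atom x a)); rewrite ltnS leqNgt xz.
Qed.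

(** * Deleting an atom from a basis *)

Lemma bases_join x I : I \in bases x -> (\join_(a in I) val a)%O = x.
Proof. by rewrite inE => /andP[_ /eqP]. Qed.

(** Deleting [a] from a basis of [y] lowers the rank of the join by exactly one:
    [rank_joins_atoms] gives at least one, [rank_join_atom] at most one.
    Conversely, [covers_join_atom] forbids [a] from lying below [x], hence from
    being in [J], when [x `|` a] covers [x]. *)
Lemma basis_setU1 a y J :
  let x := (\join_(b in J) val b)%O in
  (a \notin J) && (a |: J \in bases y) =
  (covers x y && ((x `|` val a)%O == y)) && (J \in bases x).
Proof.
move=> x; have [gr _ _] := gL.
rewrite !inE eqxx andbT; apply/idP/idP => [/and3P[aJ]|].
  rewrite cardsU1 aJ add1n big_setU1 //= -/x joinC => /eqP cJ /eqP xy.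
  have rx : #|J| = rank x.
    apply/eqP; rewrite eqn_leq rank_joins_atoms andbT -ltnS cJ -xy.
    exact: rank_join_atom.
  rewrite rx eqxx xy eqxx !andbT -{1}xy covers_join_atom.
  apply/negP => /join_idPl xa; move: cJ.
  by rewrite -xy xa rx => /eqP; rewrite eqn_leq ltnn.
move=> /andP[/andP[cxy /eqP xy] /eqP cJ].
have aJ : a \notin J.
  have : ~~ (val a <= x)%O by rewrite -covers_join_atom xy.
  by apply: contra => aJ; apply: joins_sup.
by rewrite aJ cardsU1 aJ add1n big_setU1 //= -/x joinC xy cJ (gr _ _ cxy) !eqxx.
Qed.

End Rank.

(** * Squarefree monomials *)

Section Monomials.
Context {R : realType} {d : Order.disp_t} {L : finTBLatticeType d}.
Implicit Types (a : atom_of L) (I : {set atom_of L}).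

Definition set_mnm I : 'X_{1..#|{: atom_of L}|} :=
  [multinom (enum_val i \in I : nat) | i < #|{: atom_of L}|].

Lemma set_mnmE I a : set_mnm I (enum_rank a) = (a \in I).
Proof. by rewrite mnmE enum_rankK. Qed.

Lemma set_mnm_inj : injective set_mnm.
Proof.
move=> I J eqIJ; apply/setP => a.
by have := congr1 (fun m : 'X_{1.._} => m (enum_rank a)) eqIJ;
  rewrite !set_mnmE; case: (a \in I); case: (a \in J).
Qed.

Lemma zmonE I : zmon I = 'X_[set_mnm I] :> polyA R L.
Proof.
rewrite mpolyXE_id (reindex _ (onW_bij _ (@enum_rank_bij (atom_of L)))) /=.
rewrite /zmon big_mkcond; apply: eq_bigr => a _.
by rewrite set_mnmE; case: (a \in I).
Qed.

Lemma mcoeff_zmon I J : (zmon I : polyA R L)@_(set_mnm J) = (I == J)%:R.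
Proof. by rewrite zmonE mcoeffX (inj_eq set_mnm_inj). Qed.

Lemma pderiv_zmon a I :
  pderiv a (zmon I) = if a \in I then zmon (I :\ a) else 0 :> polyA R L.
Proof.
rewrite /pderiv zmonE mderivX set_mnmE; case: ifP => aI; last by rewrite mulr0n scale0r.
rewrite mulr1n scale1r zmonE; congr 'X_[_]; apply/mnmP => i.
rewrite mnmBE mnm1E -(enum_valK i) !set_mnmE (inj_eq enum_rank_inj) !inE eq_sym.
by have [->|_] := eqVneq (enum_val i) a; rewrite ?aI ?subn0.
Qed.

End Monomials.

(** * Basis generating polynomials *)

Section BasisPoly.
Context {R : realType} {d : Order.disp_t} {L : finTBLatticeType d}.
Implicit Types (x y : L) (a : atom_of L) (I J : {set atom_of L}).
Implicit Types v : freemod R L.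

(** A set of atoms is a basis of at most one element, so each monomial of
    [Phi_beta v] comes from a single term. *)
Lemma mcoeff_Phi_beta v x I : I \in bases x ->
  (Phi_beta v)@_(set_mnm I) = v x / (beta x)%:R.
Proof.
move=> Ix; rewrite /= /lin_ext raddf_sum (bigD1 x) //= [X in _ + X]big1 ?addr0.
  rewrite !mcoeffZ raddf_sum (bigD1 I) //= mcoeff_zmon eqxx big1 ?addr0 ?mulr1 //.
  by move=> J /andP[_ nJI]; rewrite mcoeff_zmon (negPf nJI).
move=> y nyx; rewrite !mcoeffZ raddf_sum big1 ?mulr0 // => J Jy.
rewrite /= mcoeff_zmon; case: eqP => // eJI; case/eqP: nyx.
by rewrite -(bases_join _ _ Jy) -(bases_join _ _ Ix) eJI.
Qed.

Lemma multiaffine_Phi_beta v : multiaffine (Phi_beta v).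
Proof.
exists (fun I => \sum_(x | I \in bases x) v x / (beta x)%:R).
under [RHS]eq_bigr do rewrite scaler_suml.
rewrite (exchange_big_dep predT) //= /lin_ext; apply: eq_bigr => x _.
by rewrite scalerA scaler_sumr.
Qed.

Hypothesis gL : geometric L.

Lemma Phi_beta_inj : injective (Phi_beta : freemod R L -> polyA R L).
Proof.
move=> u v eq_uv; apply/ffunP => x; have [I Ix] := has_basis x gL.
have := mcoeff_Phi_beta u _ _ Ix; rewrite eq_uv (mcoeff_Phi_beta v _ _ Ix).
by move/mulIf => -> //; rewrite invr_eq0 pnatr_eq0 -lt0n beta_gt0.
Qed.

(** The bijection [J |-> a |: J] of [basis_setU1], read on generating
    polynomials. *)
Lemma pderiv_basis_poly a y :
  pderiv a (basis_poly y) =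
  \sum_(x | covers x y && ((x `|` val a)%O == y)) basis_poly x :> polyA R L.
Proof.
pose P x := covers x y && ((x `|` val a)%O == y).
pose jn J := (\join_(b in J) val b)%O : L.
have -> : \sum_(x | P x) basis_poly x =
    \sum_(J | P (jn J) && (J \in bases (jn J))) (zmon J : polyA R L).
  rewrite (exchange_big_dep predT) //= [RHS]big_mkcond; apply: eq_bigr => J _.
  rewrite big_mkcond (bigD1 (jn J)) //= big1 ?addr0 // => x nxJ.
  by case: ifP => // /andP[_ /bases_join xJ]; rewrite -xJ eqxx in nxJ.
rewrite /pderiv /basis_poly raddf_sum /=.
under eq_bigr => I _ do rewrite -/(pderiv a _) pderiv_zmon.
rewrite -big_mkcondr /= (reindex_onto (fun J => a |: J) (fun I => I :\ a)) /=; last first.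
  by move=> I /andP[_ aI]; rewrite setD1K.
apply: eq_big => [J|J /andP[_ /eqP-> //]].
rewrite -(basis_setU1 gL) setU11 andbT andbC; congr (_ && _).
apply/eqP/idP => [<-|aJ]; first by rewrite setD11.
by rewrite setU1K.
Qed.

End BasisPoly.

(** * The adjoint of multiplication by an atom *)

Section Adjoint.
Context {R : realType} {d : Order.disp_t} {L : finTBLatticeType d}.

Lemma adjoint_mul_atom (gL : geometric L) (a : atom_of L)
    (M : {linear freemod R L -> freemod R L}) (y : L) :
  is_adjoint_beta (mul_atom a) M ->
  M (evec y) =
  \sum_(x : L | covers x y && ((x `|` val a)%O == y))
     ((beta x)%:R / (beta y)%:R) *: (evec x : freemod R L).
Proof.
move=> adjM; apply/ffunP => x.
have bx : (beta x)%:R != 0 :> R by rewrite pnatr_eq0 -lt0n beta_gt0.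
have -> : M (evec y) x = (beta x)%:R * ip_beta (mul_atom a (evec x)) (evec y).
  by rewrite adjM ip_beta_el mulrC divfK.
have -> : ip_beta (mul_atom a (evec x)) (evec y) =
    (covers x y && ((x `|` val a)%O == y))%:R / (beta y)%:R :> R.
  rewrite /= lin_ext_e; have [xy|nxy] := eqVneq (x `|` val a)%O y.
    rewrite -{2}xy (covers_join_atom gL) andbT; case: ifP => _ /=.
      by rewrite mul0r /ip_beta big1 // => z _; rewrite ffunE !mul0r.
    by rewrite ip_beta_el xy ffunE eqxx.
  rewrite andbF mul0r; case: ifP => _.
    by rewrite /ip_beta big1 // => z _; rewrite ffunE !mul0r.
  by rewrite ip_beta_el ffunE (negPf nxy) mul0r.
rewrite sum_ffunE big_mkcond (bigD1 x) //= big1 ?addr0 => [|z nzx].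
  case: ifP => _; last by rewrite mul0r mulr0.
  by rewrite !ffunE eqxx /GRing.scale /= mulr1 mul1r.
by case: ifP => // _; rewrite !ffunE eq_sym (negPf nzx) scaler0.
Qed.

End Adjoint.

Theorem proposition2p2 (R : realType) (d : Order.disp_t)
    (L : finTBLatticeType d) (gL : geometric L)
    (Lb : atom_of L -> {linear freemod R L -> freemod R L})
    (adjLb : forall a : atom_of L, is_adjoint_beta (mul_atom a) (Lb a)) :
  (forall (a : atom_of L) (y : L),
     Lb a (evec y) =
     \sum_(x : L | covers x y && ((x `|` val a)%O == y))
        ((beta x)%:R / (beta y)%:R) *: (evec x : freemod R L))
  /\ (forall v : freemod R L, multiaffine (Phi_beta v))
  /\ injective (Phi_beta : freemod R L -> polyA R L)
  /\ (forall (a : atom_of L) (y : L),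
        Phi_beta (Lb a (evec y)) = pderiv a (Phi_beta (evec y))).
Proof.
have LbE a y := adjoint_mul_atom gL a (Lb a) y (adjLb a).
split; first exact: LbE.
split; first exact: multiaffine_Phi_beta.
split; first exact: Phi_beta_inj.
move=> a y; rewrite LbE linear_sum {2}/Phi_beta /= lin_ext_e.
rewrite /pderiv mderivZ -/(pderiv a _) (pderiv_basis_poly gL) scaler_sumr.
apply: eq_bigr => x _; rewrite linearZ /= lin_ext_e scalerA.
by rewrite mulrAC mulfV ?mul1r // pnatr_eq0 -lt0n beta_gt0.
Qed.
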